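(* Let $n$ be an odd prime number and let $q$ be a prime power. Define $f:\{1,\dots,n\}\to\mathbb{F}_q$ by: for $1\le i\le n-1$, $f(i)=0$ if $i$ is a quadratic residue modulo $n$ and $f(i)=1$ if $i$ is a quadratic nonresidue modulo $n$; and $f(n)=f(0)=0$. Then $f$ is a most complicated function of every translation-invariant operator $A$ on $\mathbb{F}_q^n$ if and only if there is an integer $k$ such that either $n=4k+3$ and $\gcd(q,k+1)=1$ and $\gcd(q,2k+1)=1$, or $n=4k+1$ and $\gcd(q,2k)=1$.
   Context: $\mathbb{F}_q$ is the finite field with $q$ elements. Vectors of $\mathbb{F}_q^n$ are columns $x=(x_1,\dots,x_n)^T$. The cyclic shift operator $\delta$ on $\mathbb{F}_q^n$ is $\delta(x_1,x_2,\dots,x_n)^T=(x_2,\dots,x_n,x_1)^T$. A linear operator $A:\mathbb{F}_q^n\to\mathbb{F}_q^n$ is called translation-invariant if $A\delta=\delta A$. For a linear operator $A$ on $\mathbb{F}_q^n$ and $x\in\mathbb{F}_q^n$, the sequence $x,Ax,A^2x,\dots$ is eventually periodic; its preperiod is the least $m\ge 0$ such that $A^m x=A^{m+t}x$ for some $t\ge 1$, and its period is the length of the cycle it eventually enters. A function $f$ with values in $\mathbb{F}_q$ is identified with the vector $x=(f(1),\dots,f(n))^T$. The function $f$ is called a most complicated function of $A$ if the sequence $x,Ax,A^2x,\dots$ has both the maximal period and the maximal preperiod, the maxima being taken over all starting vectors in $\mathbb{F}_q^n$ (for the given $A$). *)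

(* Defs.v *)
From HB Require Import structures.
From mathcomp Require Import all_boot all_order all_algebra all_field.

Set Implicit Arguments.
Unset Strict Implicit.
Unset Printing Implicit Defensive.

Import GRing.Theory.
Local Open Scope ring_scope.

Section EventuallyPeriodic.
Local Open Scope nat_scope.
Variables (T : finType) (f : T -> T).

(* The boolean form, over a finite type, of: f^m x = f^(m+t) x for some t >= 1;
   see recursP. *)
Definition recurs (x : T) (m : nat) : bool :=
  fconnect f (f (iter m f x)) (iter m f x).

Lemma recursP (x : T) (m : nat) :
  reflect (exists2 t, 1 <= t & iter m f x = iter (m + t) f x) (recurs x m).
Proof.
apply: (iffP idP) => [/iter_findex <-|[t t_gt0 e]].
  set k := findex _ _ _; exists (k.+1 + 0); first by rewrite addn0.
  rewrite /k addn0 addnC iterD iterSr.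
  by move: (iter m f x) @k => y k; rewrite /k.
rewrite /recurs {2}e addnC iterD -(prednK t_gt0) iterSr.
exact: fconnect_iter.
Qed.

Lemma ex_recurs (x : T) : exists m, recurs x m.
Proof.
have /trajectP [i lt_i e] := looping_order f x.
exists i; apply/recursP; exists (order f x - i); first by rewrite subn_gt0.
by rewrite -e subnKC // ltnW.
Qed.

Definition preperiod (x : T) : nat := ex_minn (ex_recurs x).

(* The cycle entered by x, f x, f (f x), ... is the orbit of its first
   recurring term. *)
Definition period (x : T) : nat := order f (iter (preperiod x) f x).

Lemma preperiod_least (x : T) :
  (exists2 t, 1 <= t & iter (preperiod x) f x = iter (preperiod x + t) f x)
  /\ forall m, (exists2 t, 1 <= t & iter m f x = iter (m + t) f x) ->
       preperiod x <= m.
Proof.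
rewrite /preperiod; case: ex_minnP => m /recursP m_rec m_min.
by split=> // k /recursP; apply: m_min.
Qed.

Lemma cycle_period (x : T) :
  exists c : seq T, [/\ ufcycle f c, iter (preperiod x) f x \in c
                      & size c = period x].
Proof.
rewrite /period; have: recurs x (preperiod x).
  by have [/recursP] := preperiod_least x.
rewrite /recurs; set y := iter _ f x => fy_y; exists (orbit f y).
split; [apply/andP; split | exact: in_orbit | exact: size_orbit].
  by rewrite -fconnect_f.
exact: orbit_uniq.
Qed.

End EventuallyPeriodic.

Section TranslationInvariance.
Variables (F : finFieldType) (n : nat).

(* 'I_n is 0-based: the coordinate x_j, 1 <= j <= n, is x i 0 with j = i.+1;
   ordS is the cyclic successor. *)
Definition shift (x : 'cV[F]_n) : 'cV[F]_n := \col_i x (ordS i) 0.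

Definition translation_invariant (A : 'cV[F]_n -> 'cV[F]_n) : Prop :=
  A \o shift =1 shift \o A.

Definition vec_of_fun (f : nat -> F) : 'cV[F]_n := \col_i f i.+1.

Definition most_complicated (A : 'cV[F]_n -> 'cV[F]_n) (f : nat -> F) : Prop :=
  period A (vec_of_fun f) = \max_(y : 'cV[F]_n) period A y
  /\ preperiod A (vec_of_fun f) = \max_(y : 'cV[F]_n) preperiod A y.

End TranslationInvariance.

Definition quadratic_residue (n i : nat) : bool :=
  ~~ (n %| i)%N && [exists x : 'I_n, x ^ 2 == i %[mod n]]%N.

Definition quadratic_nonresidue (n i : nat) : bool :=
  ~~ (n %| i)%N && ~~ quadratic_residue n i.

(* The value is 0 at the quadratic residues and at the multiples of n. *)
Definition nonresidue_fun (F : finFieldType) (n i : nat) : F :=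
  if quadratic_nonresidue n i then 1 else 0.

(* Main.v *)
Require Import Defs.
From HB Require Import structures.
From mathcomp Require Import all_boot all_order all_algebra all_field.
From mathcomp Require Import zify ring.

Set Implicit Arguments.
Unset Strict Implicit.
Unset Printing Implicit Defensive.

Import Order.TTheory GRing.Theory Num.Theory.
Local Open Scope ring_scope.

(** Write [*] for cyclic convolution on the vectors indexed by Z/n, [delta] for
the unit impulse at 0 and [N] for the all-ones vector.  A translation-invariant
linear [A] satisfies [A (x * y) = x * A y] ([invariant_conv]), and conversely
every [x * _] is translation-invariant, so translation-invariant operators are
the elements of the group algebra of Z/n over [F].  Let [b] be the indicator of
the nonresidues; the vector of the theorem is a shift of it.

If [b] is invertible, then every vector is a multiple of [b], so any coincidence
[A^m b = A^(m+t) b] propagates to all vectors, and [b] has the largest period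
and preperiod ([conv_unit_max]).  If on the contrary some [a] satisfies
[a * b = b] and [a * y = 0] for a nonzero [y], then under [a * _] the vector [b]
has preperiod 0 but [y] does not ([conv_fix_kill]).

Whether [b] is invertible is read off a quadratic equation.  Let [eta] be the
quadratic character of -1.  The Jacobi sum of the character with itself shows
([nonsquare_autocorrelation]) that over the integers there is a [c] with

   [n = 4 c + eta]   and   [b * b + b = c (N + eta delta)],

while [b * N = s N] for [s = (n - 1) / 2], the number of nonresidues.

- If [c] and [s] are nonzero in [F], then
  [b * (b + delta - (c / s) N) = c eta delta], so [b] is invertible.
- If [s = 0] in [F], then [n = 1] in [F], and [delta - N] fixes [b] and
  kills [N].
- If [c = 0] in [F], then [b * b = - b], so [- b] fixes [b] and kills
  [delta + b].

Hence the property holds iff [c] and [s] are prime to [q].  For [eta = 1] one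
has [n = 4 c + 1] and [s = 2 c]; for [eta = -1] one has [n = 4 (c - 1) + 3] and
[s = 2 c - 1]: these are the two alternatives of the theorem. *)

(** * Starting vectors of maximal period and preperiod *)

Section Dynamics.
Local Open Scope nat_scope.
Variables (T : finType) (f : T -> T).

Lemma preperiod_le (x : T) m t :
  0 < t -> iter m f x = iter (m + t) f x -> preperiod f x <= m.
Proof. by move=> t_gt0 e; apply: (preperiod_least f x).2; exists t. Qed.

Lemma iter_preperiod_period (x : T) :
  iter (preperiod f x) f x = iter (preperiod f x + period f x) f x.
Proof.
have [c [/andP [c_cyc _] x_c _]] := cycle_period f x.
by rewrite addnC iterD /period (iter_order_cycle c_cyc).
Qed.

Lemma period_gt0 (x : T) : 0 < period f x.
Proof. exact: order_gt0. Qed.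

Lemma order_le_return (x : T) t : 0 < t -> iter t f x = x -> order f x <= t.
Proof.
move=> t_gt0 e; rewrite leqNgt; apply/negP => /findex_iter.
by rewrite e findex0 => t0; rewrite -t0 in t_gt0.
Qed.

(** The hypothesis says that every coincidence along the trajectory of [v]
occurs along all trajectories. Applied to the coincidence [A^m v = A^(m+P) v],
where [m] and [P] are the preperiod and period of [v], it bounds the preperiod
of [y] by [m]. It also makes [P] a return time at a point of the cycle of [y],
hence at all its points. *)
Lemma period_preperiod_max (v : T) :
    (forall m t y, iter m f v = iter (m + t) f v ->
       iter m f y = iter (m + t) f y) ->
  period f v = \max_(y : T) period f y
  /\ preperiod f v = \max_(y : T) preperiod f y.
Proof.
move=> v_recurs.
have rec_y y := v_recurs _ _ y (iter_preperiod_period v).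
have pre_le y : preperiod f y <= preperiod f v.
  exact: preperiod_le (period_gt0 v) (rec_y y).
split; apply/eqP; rewrite eqn_leq leq_bigmax /=; apply/bigmax_leqP => y _ //.
have [c [/andP [c_cyc _] y_c _]] := cycle_period f y.
apply: order_le_return (period_gt0 v) _.
set z := iter (preperiod f y) f y in y_c *.
set k := preperiod f v - preperiod f y.
set P := period f v.
have k_z : iter k f z = iter (preperiod f v) f y.
  by rewrite /z -iterD subnK.
(* [l] completes [k] to a whole number of turns of the cycle of [z]. *)
have [l l_z] : exists l, iter (l + k) f z = z.
  exists (order f z * k - k).
  rewrite subnK ?leq_pmull ?order_gt0 // mulnC.
  by elim: k {k_z} => // k IH; rewrite mulSn iterD IH (iter_order_cycle c_cyc).
have P_k : iter (P + k) f z = iter k f z.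
  by rewrite iterD k_z -iterD addnC -rec_y.
by rewrite -[in LHS]l_z -iterD addnCA iterD P_k -iterD.
Qed.

End Dynamics.

(** A fixed vector has preperiod 0, whereas a nonzero vector killed by [A] never
recurs. *)
Lemma not_most_complicated_of_fixed (F : finFieldType) (n : nat) (f : nat -> F)
    (A : {linear 'cV[F]_n -> 'cV[F]_n}) (y : 'cV[F]_n) :
    A (vec_of_fun n f) = vec_of_fun n f -> A y = 0 -> y != 0 ->
  ~ most_complicated A f.
Proof.
move=> Av Ay y_neq0 [_ pre_max].
have pre_v : preperiod A (vec_of_fun n f) = 0%N.
  by apply/eqP; rewrite -leqn0; apply: (@preperiod_le _ _ _ 0 1).
have /eqP : preperiod A y = 0%N.
  apply/eqP; rewrite -leqn0; apply: leq_trans (leq_bigmax y) _.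
  by rewrite -pre_max pre_v.
apply/negP; apply: contra y_neq0 => /eqP pre_y.
have := iter_preperiod_period A y; rewrite pre_y add0n.
case: (period A y) (period_gt0 A y) => // t _; rewrite iterSr Ay => /= ->.
by elim: t => //= t /eqP ->; rewrite linear0.
Qed.

(** * Cyclic convolution and translation-invariant operators *)

Section Convolution.
Variables (F : finFieldType) (m : nat).
Local Notation n := m.+2.
Implicit Types x y z : 'cV[F]_n.

Definition conv x y : 'cV[F]_n := \col_i \sum_j x j 0 * y (i - j) 0.

Definition unit_impulse : 'cV[F]_n := delta_mx 0 0.
Definition all_ones : 'cV[F]_n := const_mx 1.

Lemma convE x y i : conv x y i 0 = \sum_j x j 0 * y (i - j) 0.
Proof. exact: mxE. Qed.

Lemma conv_is_linear x : linear (conv x).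
Proof.
move=> a y z; apply/colP => i; rewrite !mxE mulr_sumr -big_split.
by apply: eq_bigr => j _; rewrite !mxE mulrDr mulrCA.
Qed.

HB.instance Definition _ x :=
  GRing.isLinear.Build F 'cV[F]_n 'cV[F]_n *:%R (conv x) (conv_is_linear x).

Lemma convC : commutative conv.
Proof.
move=> x y; apply/colP => i; rewrite !convE (reindex_inj (inv_inj (subKr i))).
by apply: eq_bigr => j _; rewrite subKr mulrC.
Qed.

Lemma conv_unit x : conv x unit_impulse = x.
Proof.
rewrite convC; apply/colP => i; rewrite convE.
rewrite (bigD1 0) //= big1 => [|j /negPf j0].
  by rewrite mxE !eqxx mul1r subr0 addr0.
by rewrite mxE j0 mul0r.
Qed.

Lemma conv_ones x : conv x all_ones = (\sum_i x i 0) *: all_ones.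
Proof.
apply/colP => i; rewrite convE !mxE mulr_suml.
by apply: eq_bigr => j _; rewrite mxE.
Qed.

Lemma shiftE x i : shift x i 0 = x (i + 1) 0.
Proof.
rewrite mxE; congr (x _ 0); apply: val_inj => /=.
by rewrite -[in LHS]addn1 -[in RHS]modnDmr modn_mod modnDmr.
Qed.

Lemma iter_shiftE k x i : iter k (@shift F n) x i 0 = x (i + k%:R) 0.
Proof.
elim: k i => [|k IH] i; first by rewrite addr0.
by rewrite iterS shiftE IH -addrA -natr1 [1 + _]addrC.
Qed.

Lemma shift_inj : injective (@shift F n).
Proof.
move=> x y /colP xy; apply/colP => i; have := xy (i - 1).
by rewrite !shiftE subrK.
Qed.

Lemma conv_shiftr x : translation_invariant (conv x).
Proof.
move=> y; apply/colP => i; rewrite /= shiftE !convE.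
by apply: eq_bigr => j _; rewrite shiftE addrAC.
Qed.

(** A convolution is a linear combination of shifts, which is why
translation-invariant operators pass through it. *)
Lemma conv_sum_shift x y :
  conv x y = \sum_j x j 0 *: iter (- j : 'I_n) (@shift F n) y.
Proof.
apply/colP => i; rewrite convE summxE; apply: eq_bigr => j _.
by rewrite mxE iter_shiftE natr_Zp.
Qed.

Lemma invariant_iter_shift (A : 'cV[F]_n -> 'cV[F]_n) k y :
    translation_invariant A ->
  A (iter k (@shift F n) y) = iter k (@shift F n) (A y).
Proof. by move=> A_inv; elim: k => //= k <-; apply: A_inv. Qed.

Lemma invariant_conv (A : {linear 'cV[F]_n -> 'cV[F]_n}) x y :
  translation_invariant A -> A (conv x y) = conv x (A y).
Proof.
move=> A_inv; rewrite !conv_sum_shift linear_sum; apply: eq_bigr => j _.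
by rewrite linearZ /= invariant_iter_shift.
Qed.

(** Associativity is, up to commutativity, [invariant_conv] for the operator
[conv x]. *)
Lemma convA : associative conv.
Proof.
move=> x y z.
rewrite [conv y z]convC [RHS]convC.
exact: (invariant_conv (A := conv x) _ _ (conv_shiftr x)).
Qed.

(** Since [y = (y * w) * b] for every [y], the values [A^k y = (y * w) * A^k b]
are determined by [A^k b]. *)
Lemma conv_unit_max (A : {linear 'cV[F]_n -> 'cV[F]_n}) (f : nat -> F) b w :
    vec_of_fun n f = shift b -> conv b w = unit_impulse ->
  translation_invariant A -> most_complicated A f.
Proof.
move=> f_b bw A_inv; rewrite /most_complicated f_b; apply: period_preperiod_max.
have A_shift k : iter k A (shift b) = shift (iter k A b).
  by elim: k => //= k ->; apply: A_inv.
have A_conv k x z : iter k A (conv x z) = conv x (iter k A z).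
  by elim: k => //= k ->; apply: invariant_conv.
move=> k t y; rewrite !A_shift => /shift_inj e.
have -> : y = conv (conv y w) b by rewrite -convA [conv w b]convC bw conv_unit.
by rewrite !A_conv e.
Qed.

Lemma conv_fix_kill (f : nat -> F) a b y :
    vec_of_fun n f = shift b -> conv a b = b -> conv a y = 0 -> y != 0 ->
  ~ forall A : {linear 'cV[F]_n -> 'cV[F]_n},
      translation_invariant A -> most_complicated A f.
Proof.
move=> f_b ab ay y_neq0 /(_ (conv a) (conv_shiftr a)).
apply: not_most_complicated_of_fixed ay y_neq0; rewrite f_b.
exact: etrans (conv_shiftr a b) (congr1 (@shift F n) ab).
Qed.

(** The equation [b_sqr] sends [b] to a root of [X ^ 2 + X - c * e] under each
nontrivial character of Z/n, and [s] is its image under the trivial one; so [b]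
should be invertible exactly when [s] and [c * e] are nonzero.  Explicit
multipliers show this in every characteristic, including the divisors of [n],
where there are too few characters. *)
Section QuadraticElement.
Variables (f : nat -> F) (b : 'cV[F]_n) (s c e : F).
Hypothesis f_b : vec_of_fun n f = shift b.
Hypothesis b_ones : conv b all_ones = s *: all_ones.
Hypothesis b_sqr : conv b b + b = c *: (all_ones + e *: unit_impulse).

Lemma most_complicated_of_neq0 (A : {linear 'cV[F]_n -> 'cV[F]_n}) :
    e ^+ 2 = 1 -> s != 0 -> c != 0 ->
  translation_invariant A -> most_complicated A f.
Proof.
move=> e_sqr s_neq0 c_neq0.
(* By [b_sqr] and [b_ones], [b * (b + delta - (c / s) N) = c e delta]; and
   [e = e^-1]. *)
pose w := (e / c) *: (b + unit_impulse - (c / s) *: all_ones).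
apply: (conv_unit_max (w := w) f_b).
rewrite linearZ linearB linearD linearZ /= conv_unit b_ones b_sqr.
rewrite scalerA (divfK s_neq0) [c *: (_ + _)]scalerDr.
rewrite addrAC subrr add0r [c *: (e *: _)]scalerA scalerA mulrA (divfK c_neq0).
by rewrite -expr2 e_sqr scale1r.
Qed.

(** If [s = 0], then [n = 1] in [F], so that [N] is idempotent; [b] is fixed by
the complementary idempotent [delta - N], which kills [N]. *)
Lemma sum_neq0_of_most_complicated :
    n%:R = 1 + s *+ 2 ->
    (forall A : {linear 'cV[F]_n -> 'cV[F]_n},
      translation_invariant A -> most_complicated A f) -> s != 0.
Proof.
move=> n_s f_max; apply/eqP => s0; move: f_max.
apply: (conv_fix_kill (a := unit_impulse - all_ones)
                      (y := all_ones) f_b).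
- by rewrite convC linearB /= conv_unit b_ones s0 scale0r subr0.
- rewrite convC linearB /= conv_unit conv_ones.
  under eq_bigr do rewrite mxE.
  by rewrite sumr_const card_ord n_s s0 mul0rn addr0 scale1r subrr.
apply/eqP => /colP /(_ 0); rewrite !mxE; apply/eqP; exact: oner_neq0.
Qed.

(** If [c = 0], then [b * b = - b], so [- b] is an idempotent fixing [b] and
killing [delta + b]. The condition at 0 ensures [b != - delta]. *)
Lemma const_neq0_of_most_complicated :
    b 0 0 = 0 ->
    (forall A : {linear 'cV[F]_n -> 'cV[F]_n},
      translation_invariant A -> most_complicated A f) -> c != 0.
Proof.
move=> b0 f_max; apply/eqP => c0; move: f_max.
have b_sqrN : conv b b = - b.
  by apply/eqP; rewrite -addr_eq0 b_sqr c0 scale0r.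
apply: (conv_fix_kill (a := - b) (y := unit_impulse + b) f_b).
- by rewrite convC linearN /= b_sqrN opprK.
- by rewrite linearD /= conv_unit convC linearN /= b_sqrN opprK addNr.
apply/eqP => /colP /(_ 0); rewrite !mxE b0 addr0; apply/eqP; exact: oner_neq0.
Qed.

End QuadraticElement.

End Convolution.

(** * The quadratic character of a finite field *)

Section QuadraticCharacter.
Variable K : finFieldType.
Hypothesis two_neq0 : 2 != 0 :> K.

Definition is_square (a : K) : bool := [exists x, x ^+ 2 == a].

Definition quadchar (a : K) : int :=
  if a == 0 then 0 else if is_square a then 1 else -1.

(** The equation [x ^ 2 = a] has [1 + quadchar a] solutions; summing over [a]
counts the elements of [K], so that the values of [quadchar] have sum 0. *)
Lemma sum_quadchar : \sum_a quadchar a = 0.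
Proof.
have fiber a : \sum_(x : K | x ^+ 2 == a) 1 = 1 + quadchar a.
  rewrite /quadchar; have [->|a_neq0] := eqVneq a 0.
    rewrite (bigD1 0) ?expr0n //= big1 // => x /andP [].
    by rewrite sqrf_eq0 => ->.
  case: (boolP (is_square a)) => [/existsP [x /eqP xa]|a_nsq].
    have x_neq0 : x != 0.
      by apply: contra a_neq0 => /eqP x0; rewrite -xa x0 expr0n.
    have xNx : - x != x.
      apply: contra two_neq0 => /eqP xNx.
      by rewrite -(mulrI_eq0 _ (mulfI x_neq0)) mulr_natr mulr2n -{1}xNx addNr.
    rewrite (bigD1 x) ?xa //= (bigD1 (- x)) ?sqrrN ?xa ?eqxx //= big1 //.
    move=> y /andP [/andP [+ y_x] y_Nx].
    by rewrite -xa eqf_sqr (negPf y_x) (negPf y_Nx).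
  rewrite big_pred0 // => x; apply/negP => xa; case/negP: a_nsq.
  by apply/existsP; exists x.
have : \sum_a (1 + quadchar a) = \sum_(x : K) 1.
  under eq_bigr do rewrite -fiber.
  by rewrite [RHS](partition_big (fun x : K => x ^+ 2) predT).
by rewrite big_split /= -[RHS]addr0 => /addrI.
Qed.

Lemma sum_quadcharM (a : K) : a != 0 -> \sum_b quadchar (a * b) = 0.
Proof.
move=> a_neq0; rewrite -[RHS]sum_quadchar.
by rewrite [RHS](reindex_inj (mulfI a_neq0)).
Qed.

Lemma quadchar_neq0 (a : K) : a != 0 -> quadchar a = 1 \/ quadchar a = -1.
Proof. by rewrite /quadchar => /negPf ->; case: ifP; [left|right]. Qed.

Lemma quadchar_sqr (a : K) : a != 0 -> quadchar (a ^+ 2) = 1.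
Proof.
move=> a_neq0; rewrite /quadchar /is_square sqrf_eq0 (negPf a_neq0).
by case: existsP => // -[]; exists a.
Qed.

Lemma quadchar0 : quadchar 0 = 0. Proof. by rewrite /quadchar eqxx. Qed.

Lemma quadcharM_square (x b : K) :
  x != 0 -> quadchar (x ^+ 2 * b) = quadchar b.
Proof.
move=> x_neq0; rewrite /quadchar /is_square mulf_eq0 sqrf_eq0 (negPf x_neq0) /=.
case: eqP => // _; congr (if _ then _ else _).
apply/existsP/existsP => -[y /eqP e].
  by exists (y / x); rewrite expr_div_n e mulrAC mulfV ?mul1r ?sqrf_eq0.
by exists (x * y); rewrite exprMn e.
Qed.

(** The case that needs an argument is that of a nonsquare [a].  Then
[quadchar (a * c) + quadchar c <= 0] for every [c], with equality at squares,
because a nonsquare times a square is a nonsquare.  These numbers have sum 0,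
so they all vanish. *)
Lemma quadcharM (a b : K) : quadchar (a * b) = quadchar a * quadchar b.
Proof.
have [->|a_neq0] := eqVneq a 0; first by rewrite mul0r quadchar0 mul0r.
have [/existsP [x /eqP xa]|a_nsq] := boolP (is_square a).
  have x_neq0 : x != 0.
    by apply: contra a_neq0 => /eqP x0; rewrite -xa x0 expr0n.
  by rewrite -xa quadcharM_square // quadchar_sqr // mul1r.
have -> : quadchar a = -1 by rewrite /quadchar (negPf a_neq0) (negPf a_nsq).
have term_le0 c : 0 <= - (quadchar (a * c) + quadchar c).
  have [->|c_neq0] := eqVneq c 0; first by rewrite mulr0 quadchar0.
  have [/existsP [x /eqP xc]|c_nsq] := boolP (is_square c).
    have x_neq0 : x != 0.
      by apply: contra c_neq0 => /eqP x0; rewrite -xc x0 expr0n.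
    rewrite -xc mulrC quadcharM_square // quadchar_sqr //.
    by rewrite /quadchar (negPf a_neq0) (negPf a_nsq).
  rewrite {2}/quadchar (negPf c_neq0) (negPf c_nsq).
  by rewrite /quadchar; case: ifP => //; case: ifP.
have sum0 : \sum_c - (quadchar (a * c) + quadchar c) = 0.
  by rewrite sumrN big_split /= sum_quadcharM // sum_quadchar.
have /eqP := sum0; rewrite psumr_eq0 // => /allP /(_ b).
by rewrite mem_index_enum oppr_eq0 addr_eq0 mulN1r => /(_ isT) /eqP.
Qed.

Lemma quadcharV (a : K) : quadchar a^-1 = quadchar a.
Proof.
have [->|a_neq0] := eqVneq a 0; first by rewrite invr0.
by rewrite -(quadcharM_square a^-1 a_neq0) expr2 mulfK.
Qed.

(** Substituting [i = j * u] reduces a nonzero [j] to [j = 1]. For [u != 0] the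
summand is then [quadchar (u^-1 * (1 - u)) = quadchar (u^-1 - 1)], and
[u^-1 - 1] takes every value but -1, the value missed being that of [u = 0]
under the convention [0^-1 = 0]. *)
Lemma jacobi_sum (j : K) :
  \sum_i quadchar i * quadchar (j - i)
    = quadchar (-1) * (if j == 0 then #|K|%:R - 1 else -1).
Proof.
have [->|j_neq0] := eqVneq j 0.
  under eq_bigr do rewrite sub0r -mulN1r quadcharM mulrCA -quadcharM -expr2.
  rewrite -mulr_sumr (bigD1 0) //= expr0n quadchar0 add0r; congr (_ * _).
  under eq_bigr => i i_neq0 do rewrite quadchar_sqr //.
  rewrite -[#|K|%:R]sumr_const.
  by rewrite [in RHS](bigD1 (0 : K)) //= addrAC subrr add0r.
rewrite mulrN1 (reindex_inj (mulfI j_neq0)) /=.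
have shifted : \sum_u quadchar (u - 1) = 0.
  by rewrite -[RHS]sum_quadchar [RHS](reindex_inj (addIr (-1))).
move: shifted; rewrite (reindex_inj invr_inj) (bigD1 0) //= invr0 sub0r.
move=> /eqP; rewrite addr_eq0 => /eqP ->; rewrite opprK.
rewrite (bigD1 0) //= mulr0 quadchar0 mul0r add0r.
apply: eq_bigr => u u_neq0.
rewrite -{2}[j]mulr1 -mulrBr !quadcharM mulrACA -quadcharM -expr2.
rewrite quadchar_sqr // mul1r -{1}[u]invrK quadcharV -quadcharM.
by rewrite mulrBr mulr1 mulVf.
Qed.

(** * The autocorrelation of the nonsquares *)

Definition nonsquare (a : K) : int := (~~ is_square a)%:R.

Lemma is_square0 : is_square 0.
Proof. by apply/existsP; exists 0; rewrite expr0n. Qed.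

Lemma quadchar_nonsquare (a : K) :
  2 * nonsquare a = 1 - quadchar a - (a == 0)%:R.
Proof.
rewrite /nonsquare /quadchar; have [->|_] := eqVneq a 0.
  by rewrite is_square0.
by case: (is_square a).
Qed.

Lemma quadcharN1 : quadchar (-1) = 1 \/ quadchar (-1) = -1.
Proof. by apply: quadchar_neq0; rewrite oppr_eq0 oner_eq0. Qed.

Lemma sum_nonsquare : 2 * \sum_i nonsquare i = #|K|%:R - 1.
Proof.
rewrite mulr_sumr; under eq_bigr do rewrite quadchar_nonsquare.
rewrite sumrB sumrB sum_quadchar subr0 sumr_const; congr (_ - _).
by rewrite (bigD1 0) //= eqxx big1 ?addr0 // => i /negPf ->.
Qed.

Lemma sum_delta (j : K) (g : K -> int) : \sum_i (i == j)%:R * g i = g j.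
Proof.
rewrite (bigD1 j) //= eqxx mul1r big1 ?addr0 // => i /negPf ->.
by rewrite mul0r.
Qed.

Lemma sum_reflect (j : K) (g : K -> int) : \sum_i g (j - i) = \sum_i g i.
Proof. by rewrite [RHS](reindex_inj (inv_inj (subKr j))). Qed.

(** Expand with [2 * nonsquare i = 1 - quadchar i - (i == 0)], the product of
the characters giving the Jacobi sum. *)
Lemma nonsquare_autocorrelation4 (j : K) :
  4 * (\sum_i nonsquare i * nonsquare (j - i) + nonsquare j)
    = (#|K|%:R - quadchar (-1)) * (1 + quadchar (-1) * (j == 0)%:R).
Proof.
have -> : 4 * (\sum_i nonsquare i * nonsquare (j - i) + nonsquare j)
    = \sum_i (2 * nonsquare i) * (2 * nonsquare (j - i))
      + 2 * (2 * nonsquare j).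
  rewrite mulrDr mulr_sumr [2 * (2 * _)]mulrA; congr (_ + _).
  by apply: eq_bigr => i _; rewrite mulrACA.
have expand i : (2 * nonsquare i) * (2 * nonsquare (j - i))
    = 1 - quadchar i - quadchar (j - i) + quadchar i * quadchar (j - i)
      - (i == 0)%:R * (1 - quadchar (j - i) - (j - i == 0)%:R)
      - (i == j)%:R * (1 - quadchar i).
  rewrite !quadchar_nonsquare subr_eq0 [j == i]eq_sym.
  ring.
under eq_bigr do rewrite expand.
have sum1 : \sum_(i : K) 1 = #|K|%:R :> int by exact: sumr_const.
rewrite !sumrB big_split !sumrB !sum_delta sum_reflect sum_quadchar sum1 /=.
rewrite jacobi_sum quadchar_nonsquare !subr0.
have [->|_] := eqVneq j 0; last by rewrite mulr0n; ring.
by rewrite quadchar0 mulr1n; case: quadcharN1 => ->; ring.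
Qed.

(** At [j = 1], [nonsquare_autocorrelation4] exhibits [#|K| - quadchar (-1)] as a
multiple of 4; this is how the residue of [#|K|] modulo 4 determines whether -1
is a square. *)
Lemma nonsquare_autocorrelation : exists c : int,
  #|K|%:R = 4 * c + quadchar (-1) /\
  forall j, \sum_i nonsquare i * nonsquare (j - i) + nonsquare j
              = c * (1 + quadchar (-1) * (j == 0)%:R).
Proof.
exists (\sum_i nonsquare i * nonsquare (1 - i) + nonsquare 1).
have e1 := nonsquare_autocorrelation4 1.
rewrite oner_eq0 mulr0 addr0 mulr1 in e1.
split=> [|j]; first by rewrite e1 subrK.
by apply: (@mulfI _ 4) => //; rewrite mulrA e1 nonsquare_autocorrelation4.
Qed.

End QuadraticCharacter.

(** * The nonresidues modulo a prime *)

(** The order of [F] is a power of its characteristic. *)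
Lemma gcdz_card_eq1 (F : finFieldType) (a : int) :
  gcdz #|F| a = 1 <-> a%:~R != 0 :> F.
Proof.
have [p p_pr pF] := finPcharP F.
have cardF : #|F| = (p ^ logn p #|F|)%N := card_pprimeChar pF.
have log_gt0 : (0 < logn p #|F|)%N.
  by case: (logn p #|F|) cardF (finNzRing_gt1 F) => // ->.
rewrite -(dvdz_pcharf pF) /= dvdzE /=.
rewrite -prime_coprime // -(coprime_pexpl _ _ log_gt0).
rewrite -cardF; split => [[/eqP]//|/eqP co]; by congr Posz.
Qed.

(** The dimension is written [(Zp_trunc (pdiv p)).+2], so that the type of
coordinates is literally the field ['F_p]; this number equals [p] when [p] is
prime. *)
Section PrimeField.
Variables (p : nat) (F : finFieldType).
Local Notation n := (Zp_trunc (pdiv p)).+2.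

Lemma quadratic_nonresidueE (i : 'F_p) :
  quadratic_nonresidue n i = ~~ is_square i.
Proof.
have dvd_i : (n %| i)%N = (i == 0).
  by rewrite /dvdn modn_small ?ltn_ord.
have sq_i : [exists x : 'I_n, x ^ 2 == i %[mod n]]%N = is_square i.
  apply: eq_existsb => x; rewrite -val_eqE /=.
  by rewrite [X in _ == X]modn_small ?ltn_ord.
rewrite /quadratic_nonresidue /quadratic_residue dvd_i sq_i.
by have [->|] := eqVneq i 0; rewrite ?is_square0.
Qed.

Lemma nonresidue_fun_mod k i :
  nonresidue_fun F k (i %% k) = nonresidue_fun F k i.
Proof.
rewrite /nonresidue_fun /quadratic_nonresidue /quadratic_residue.
by rewrite /dvdn modn_mod.
Qed.

Definition nonsquare_vec : 'cV[F]_n := \col_i (nonsquare (i : 'F_p))%:~R.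

(** Coordinate [i] of [vec_of_fun] is the value at [i.+1], hence the shift. *)
Lemma vec_nonresidue_fun :
  vec_of_fun n (nonresidue_fun F n) = shift nonsquare_vec.
Proof.
apply/colP => i; rewrite !mxE -nonresidue_fun_mod.
rewrite /nonresidue_fun /nonsquare -(quadratic_nonresidueE (ordS i)).
by case: quadratic_nonresidue.
Qed.

Lemma most_complicated_nonresidue_fun_Fp : odd n ->
  (forall A : {linear 'cV[F]_n -> 'cV[F]_n},
     translation_invariant A -> most_complicated A (nonresidue_fun F n))
  <->
  exists k : int,
    [/\ n%:Z = 4 * k + 3, gcdz #|F| (k + 1) = 1 & gcdz #|F| (2 * k + 1) = 1]
    \/ (n%:Z = 4 * k + 1 /\ gcdz #|F| (2 * k) = 1).
Proof.
move=> n_odd.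
have two_neq0 : 2 != 0 :> 'F_p.
  rewrite -val_eqE /=; case: (Zp_trunc (pdiv p)) n_odd => // -[] //.
have card_n : #|'F_p|%:R = n%:Z by rewrite card_ord natz.
have [c [n_c b_sqr]] := nonsquare_autocorrelation two_neq0.
have s_n := sum_nonsquare two_neq0; rewrite card_n in n_c s_n.
have eta_N1 := quadcharN1 'F_p.
set eta := quadchar (-1) in n_c b_sqr eta_N1.
set s := \sum_i nonsquare i in s_n.
have eta_sqr : (eta%:~R : F) ^+ 2 = 1.
  by case: eta_N1 => ->; rewrite ?sqrrN expr1n.
have b_ones : conv nonsquare_vec (all_ones F _) = s%:~R *: all_ones F _.
  rewrite conv_ones; congr (_ *: _); rewrite rmorph_sum; apply: eq_bigr => i _.
  by rewrite mxE.
have b_sqrF : conv nonsquare_vec nonsquare_vec + nonsquare_vec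
    = c%:~R *: (all_ones F _ + eta%:~R *: unit_impulse F _).
  apply/colP => j; have /(congr1 (intr : int -> F)) := b_sqr j.
  rewrite !(rmorphD, rmorphM, rmorph_sum) rmorph_nat !mxE /= andbT => <-.
  by congr (_ + _); apply: eq_bigr => i _; rewrite !mxE rmorphM.
have n_sF : n%:R = 1 + (s%:~R : F) *+ 2.
  have n_s : n%:Z = 1 + 2 * s by rewrite s_n [RHS]addrC subrK.
  by rewrite pmulrn n_s rmorphD rmorphM /= mulr_natl.
have b0 : nonsquare_vec 0 0 = 0 by rewrite mxE /nonsquare is_square0.
have f_b := vec_nonresidue_fun.
(* What remains after this step is to express [s] and [c] through [k]. *)
have -> : (forall A : {linear 'cV[F]_n -> 'cV[F]_n},
     translation_invariant A -> most_complicated A (nonresidue_fun F n))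
  <-> gcdz #|F| s = 1 /\ gcdz #|F| c = 1.
  rewrite !gcdz_card_eq1; split=> [f_max|[s_neq0 c_neq0] A].
    split; first exact: sum_neq0_of_most_complicated f_b b_ones n_sF f_max.
    exact: const_neq0_of_most_complicated f_b b_sqrF b0 f_max.
  exact: most_complicated_of_neq0 f_b b_ones b_sqrF A eta_sqr s_neq0 c_neq0.
case: eta_N1 n_c => -> n_c.
  (* When -1 is a square, [n = 4 c + 1], so [k = c] and [s = 2 k]. *)
  have s_c : s = 2 * c by lia.
  split=> [[s1 _]|[k [[n_k _ _]|[n_k k1]]]].
  - by exists c; right; rewrite -s_c.
  - by lia.
  have -> : c = k by lia.
  have -> : s = 2 * k by lia.
  split=> //; apply/gcdz_card_eq1; move/gcdz_card_eq1: k1.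
  by apply: contra => /eqP k0; rewrite rmorphM /= k0 mulr0.
(* When -1 is not a square, [n = 4 c - 1], so [k = c - 1] and [s = 2 k + 1]. *)
split=> [[s1 c1]|[k [[n_k k1 s1]|[n_k _]]]]; last by lia.
- exists (c - 1); left; split; first lia; first by rewrite subrK.
  by rewrite (_ : _ + 1 = s) //; lia.
have -> : c = k + 1 by lia.
by have -> : s = 2 * k + 1 by lia.
Qed.

End PrimeField.

Theorem theorem1 (n : nat) (n_prime : prime n) (n_odd : odd n)
    (q : nat) (F : finFieldType) (card_F : #|F| = q) :
  (forall A : {linear 'cV[F]_n -> 'cV[F]_n},
     translation_invariant A -> most_complicated A (nonresidue_fun F n))
  <->
  exists k : int,
    [/\ n%:Z = 4 * k + 3, gcdz q (k + 1) = 1 & gcdz q (2 * k + 1) = 1]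
    \/ (n%:Z = 4 * k + 1 /\ gcdz q (2 * k) = 1).
Proof.
have := @most_complicated_nonresidue_fun_Fp n F.
by rewrite (Fp_cast n_prime) card_F; apply.
Qed.
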